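(* Let $S$ be a numerical semigroup. Then the associated semigroup $A(\widetilde{S})$ of its complement has at most one small atom. Moreover, if $S$ has more than one small atom, then $A(\widetilde{S})$ has no small atoms.
   Context: $\mathbb{N}=\{0,1,2,\dots\}$. A numerical set is a subset $S\subseteq\mathbb{N}$ with $0\in S$ and $\mathbb{N}\setminus S$ finite. Its gaps are the elements of $\mathbb{N}\setminus S$, and $F(S)$ is the largest gap, with $F(\mathbb{N})=-1$. A numerical semigroup is a numerical set closed under addition. The associated semigroup of a numerical set $S$ is $A(S)=\{s\in S\mid s+S\subseteq S\}$; it is a numerical semigroup with $F(A(S))=F(S)$. An atom of a numerical semigroup $T$ is a positive element of $T$ that is not a sum of two positive elements of $T$. A small atom is an atom smaller than $F(T)$. For $S\neq\mathbb{N}$, the base is $B(S)=\max\{s\in S\mid s<F(S)\}$. Young diagram of $S$: it has one left-justified row for each gap $\ell$. The top row corresponds to $F(S)$, and the gaps decrease going down. The row for $\ell$ has length $|\{s\in S\mid s<\ell\}|$. This is a bijection between numerical sets and Young diagrams, with $\mathbb{N}$ corresponding to the empty diagram. The complement of a Young diagram with rows $\lambda_1\ge\dots\ge\lambda_g$ has rows $\lambda_1-\lambda_g\ge\dots\ge\lambda_1-\lambda_1$, zero rows being discarded. Geometrically, this is the rest of the $g\times\lambda_1$ rectangle rotated by $180^\circ$. The complement $\widetilde{S}$ is the numerical set whose Young diagram is the complement of that of $S$. One has $\widetilde{\mathbb{N}}=\mathbb{N}$, and for $S\neq\mathbb{N}$ equivalently $\widetilde{S}=\{B(S)-s\mid s\in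 S,\ s\le B(S)\}\cup\{n\mid n\ge B(S)\}$. *)

(* Defs.v *)
From mathcomp Require Import all_boot all_order all_algebra.
From mathcomp Require Import finmap.
From mathcomp Require Import boolp classical_sets cardinality.

Set Implicit Arguments.
Unset Strict Implicit.
Unset Printing Implicit Defensive.

Local Open Scope classical_set_scope.

Definition numerical_set (S : set nat) : Prop :=
  S 0 /\ finite_set (~` S).

Definition numerical_semigroup (S : set nat) : Prop :=
  numerical_set S /\ (forall x y, S x -> S y -> S (x + y)).

(* In decreasing order.  [fset_set] is [fset0] on infinite sets, so this is
   meaningful only when S is cofinite. *)
Definition gaps (S : set nat) : seq nat := sort geq (fset_set (~` S)).

Definition frobenius (S : set nat) : int :=
  if gaps S is l :: _ then Posz l else (-1)%R.

Definition associated_semigroup (S : set nat) : set nat :=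
  [set s | S s /\ [set s + t | t in S] `<=` S].

Definition atom (T : set nat) (a : nat) : Prop :=
  [/\ T a, 0 < a &
      ~ exists x y, [/\ T x, T y, 0 < x, 0 < y & a = x + y]].

Definition small_atom (T : set nat) (a : nat) : Prop :=
  atom T a /\ (Posz a < frobenius T)%R.

(* Young diagrams are given by the sequence of their row lengths, from top to
   bottom. *)
Definition is_diagram (d : seq nat) : bool :=
  sorted geq d && all (leq 1) d.

Definition diagram (S : set nat) : seq nat :=
  [seq count [in S] (iota 0 l) | l <- gaps S].

(* The gap whose row has length l, with the rows d' below it, is larger than
   exactly l elements of the set and [size d'] gaps, hence equals
   [l + size d']. *)
Fixpoint diagram_gaps (d : seq nat) : seq nat :=
  if d is l :: d' then l + size d' :: diagram_gaps d' else [::].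

(* The numerical set with diagram d; see [set_of_diagramK] and [diagramK]. *)
Definition set_of_diagram (d : seq nat) : set nat :=
  [set n | n \notin diagram_gaps d].

Definition complement_diagram (d : seq nat) : seq nat :=
  [seq l <- [seq head 0 d - k | k <- rev d] | 0 < l].

Definition complement (S : set nat) : set nat :=
  set_of_diagram (complement_diagram (diagram S)).

Lemma mem_gaps (S : set nat) n :
  finite_set (~` S) -> (n \in gaps S) = (n \notin S).
Proof.
move=> Sfin; rewrite mem_sort in_fset_set //.
by apply/idP/idP; rewrite !inE => /= H; [apply/negP|move/negP: H]; rewrite inE.
Qed.

Lemma gaps_sorted (S : set nat) : sorted gtn (gaps S).
Proof.
rewrite gtn_sorted_uniq_geq sort_uniq fset_uniq.
by apply: sort_sorted => x y /=; exact: leq_total.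
Qed.

Lemma gtn_transitive : transitive gtn.
Proof. by move=> y x z /= yx zy; apply: ltn_trans zy yx. Qed.

Lemma geq_transitive : transitive geq.
Proof. by move=> y x z /= yx zy; apply: leq_trans zy yx. Qed.

Lemma gaps_unique (S : set nat) (g : seq nat) :
  sorted gtn g -> finite_set (~` S) -> (forall n, S n <-> n \notin g) ->
  gaps S = g.
Proof.
move=> gs Sfin Sg; apply: (irr_sorted_eq gtn_transitive _ (gaps_sorted S) gs).
  by move=> x /=; rewrite ltnn.
move=> n; rewrite mem_gaps //; apply/idP/idP => [/negP|] H.
  by apply: contraT => /Sg ?; case: H; rewrite inE.
by apply/negP; rewrite inE => /Sg; rewrite H.
Qed.

(* In a strictly decreasing list of gaps, [size g'] gaps lie below the head. *)
Lemma count_below (S : set nat) (s : seq nat) (l : nat) (g' : seq nat) :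
  (forall n, S n <-> n \notin s ++ l :: g') -> sorted gtn (s ++ l :: g') ->
  count [in S] (iota 0 l) + size g' = l.
Proof.
move=> Sg; rewrite (sorted_pairwise gtn_transitive) pairwise_cat /=.
case/and3P => /allrelP sl _ /andP[/allP lg' pg'].
have -> : size g' = count (predC [in S]) (iota 0 l).
  rewrite -size_filter; apply/perm_size/uniq_perm.
  - by apply: (sorted_uniq gtn_transitive); rewrite ?sorted_pairwise //;
      [move=> x /=; rewrite ltnn | exact: gtn_transitive].
  - exact/filter_uniq/iota_uniq.
  move=> n; rewrite mem_filter mem_iota add0n /=.
  have -> : (n \notin S) = (n \in s ++ l :: g').
    apply/idP/idP => [/negP|] H.
      by apply: contraT => /Sg ?; case: H; rewrite inE.
    by apply/negP; rewrite inE => /Sg; rewrite H.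
  rewrite mem_cat inE; apply/idP/idP => [ng'|/andP[/or3P[ns|/eqP->|//] nl]].
  - by rewrite ng' !orbT; exact: lg'.
  - have := sl _ l ns (mem_head _ _); rewrite /= => ln.
    by move: (ltn_trans nl ln); rewrite ltnn.
  - by move: nl; rewrite ltnn.
by rewrite count_predC size_iota.
Qed.

Lemma mem_diagram_gaps d n :
  sorted geq d -> n \in diagram_gaps d -> n < head 0 d + size d.
Proof.
elim: d n => // l d IH n ds /=; rewrite inE => /predU1P[->|nd].
  by rewrite addnS.
have /IH /(_ nd) nlt := path_sorted ds.
apply: leq_trans nlt _; rewrite leq_add //.
by case: d ds {IH nd} => //= k d /andP[].
Qed.

Lemma diagram_gaps_sorted d : sorted geq d -> sorted gtn (diagram_gaps d).
Proof.
elim: d => //= l d IH ds; have sd := path_sorted ds.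
rewrite (path_sortedE gtn_transitive) IH // andbT; apply/allP => n nd /=.
apply: leq_trans (mem_diagram_gaps sd nd) _; rewrite leq_add //.
by case: d ds {IH sd nd} => //= k d /andP[].
Qed.

Lemma set_of_diagram_numerical d :
  is_diagram d -> numerical_set (set_of_diagram d).
Proof.
case/andP=> _ dpos; split.
  rewrite /set_of_diagram /=; elim: d dpos => //= l d IH /andP[l0 /IH].
  by rewrite inE negb_or => ->; rewrite andbT eq_sym -lt0n addn_gt0 l0.
apply: (@sub_finite_set _ _ [set` diagram_gaps d]); last exact: finite_seq.
by move=> n /= /negP; rewrite negbK.
Qed.

Lemma gaps_set_of_diagram d :
  is_diagram d -> gaps (set_of_diagram d) = diagram_gaps d.
Proof.
move=> dd; have [_ fin] := set_of_diagram_numerical dd.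
by apply: gaps_unique => //; case/andP: dd => /diagram_gaps_sorted.
Qed.

Lemma set_of_diagramK d : is_diagram d -> diagram (set_of_diagram d) = d.
Proof.
move=> dd; rewrite /diagram gaps_set_of_diagram //.
have sg : sorted gtn ([::] ++ diagram_gaps d).
  by case/andP: dd => /diagram_gaps_sorted.
have: forall n, set_of_diagram d n <-> n \notin [::] ++ diagram_gaps d by [].
have szg e : size (diagram_gaps e) = size e by elim: e => //= l e ->.
move: (set_of_diagram d) {dd} [::] sg => S.
elim: d => //= l d IH s sg Sg; congr (_ :: _).
  by apply: (@addIn (size d)); have := count_below Sg sg; rewrite szg.
by apply: (IH (rcons s (l + size d))) => [|n]; rewrite cat_rcons.
Qed.

Lemma diagram_gapsK (S : set nat) :
  numerical_set S -> diagram_gaps (diagram S) = gaps S.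
Proof.
case=> _ fin; rewrite /diagram.
have: forall n, S n <-> n \notin [::] ++ gaps S.
  by move=> n /=; rewrite mem_gaps // negbK inE.
have: sorted gtn ([::] ++ gaps S) by exact: gaps_sorted.
elim: (gaps S) [::] => //= l g IH s sg Sg; congr (_ :: _).
  by rewrite size_map; exact: count_below Sg sg.
by apply: (IH (rcons s l)) => [|n]; rewrite cat_rcons.
Qed.

Lemma diagramK (S : set nat) :
  numerical_set S -> set_of_diagram (diagram S) = S.
Proof.
move=> nS; apply/seteqP; split=> n; rewrite /set_of_diagram /= diagram_gapsK //;
  by case: nS => _ fin; rewrite mem_gaps // negbK inE.
Qed.

Lemma diagram_is_diagram (S : set nat) :
  numerical_set S -> is_diagram (diagram S).
Proof.
move=> [S0 fin]; apply/andP; split.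
  rewrite sorted_map; apply: sub_sorted (gaps_sorted S) => x y /= yx.
  by rewrite -(subnKC (ltnW yx)) iotaD count_cat leq_addr.
apply/allP => _ /mapP[l lg ->]; rewrite -has_count; apply/hasP; exists 0.
  rewrite mem_iota /= add0n lt0n; apply: contraTneq lg => ->.
  by rewrite mem_gaps // negbK inE.
by rewrite inE.
Qed.

Lemma complement_is_diagram d :
  is_diagram d -> is_diagram (complement_diagram d).
Proof.
case/andP=> ds _; rewrite /is_diagram filter_all andbT.
apply: (sorted_filter geq_transitive).
rewrite map_rev rev_sorted sorted_map; apply: sub_sorted ds => x y /= yx.
exact: leq_sub2l.
Qed.

Lemma complement_numerical (S : set nat) :
  numerical_set S -> numerical_set (complement S).
Proof.
by move=> /diagram_is_diagram/complement_is_diagram/set_of_diagram_numerical.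
Qed.

Lemma diagram_complement (S : set nat) :
  numerical_set S -> diagram (complement S) = complement_diagram (diagram S).
Proof.
by move=> /diagram_is_diagram/complement_is_diagram/set_of_diagramK.
Qed.

(* Main.v *)
(** Write [B] for the base of [S], so that the complement is
    [{n | n < B -> B - n \in S}], and let [m] be the least positive element of
    [S].  If [0 < t < B] lies in [A] (the associated semigroup of the
    complement), then [s - t \in S] for every [s \in S] with [t <= s <= B].  In
    particular [m <= B - t], so for each [s <= t] in [S] the progression
    [s + m * N] meets [t, t + m) inside [0, B], at a point [n] with [n - t \in S]
    and [n - t < m], i.e., [n = t].  Hence all elements of [S] up to [B] are
    multiples of [m], and [m] is the only possible small atom of both [A] and
    [S]. *)
Require Import Defs.
From mathcomp Require Import all_boot all_order all_algebra.
From mathcomp Require Import boolp classical_sets cardinality.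
From mathcomp Require Import zify.

Set Implicit Arguments.
Unset Strict Implicit.
Unset Printing Implicit Defensive.

Local Open Scope classical_set_scope.

(** The implication puts every [n >= B] into the set. *)
Definition reflection (B : nat) (S : set nat) : set nat :=
  [set n | n < B -> S (B - n)].

Lemma cofinite_ge (S : set nat) B :
  (forall n, B <= n -> S n) -> finite_set (~` S).
Proof.
move=> SB; apply: (@sub_finite_set _ _ `I_B); last exact: finite_II.
by move=> n /= nS; rewrite ltnNge; apply/negP => /SB.
Qed.

Lemma lt_frobeniusP (S : set nat) a :
  finite_set (~` S) -> (Posz a < frobenius S)%R ->
  exists F g, [/\ gaps S = F :: g, ~ S F & a < F].
Proof.
rewrite /frobenius => Sfin.
case gE: (gaps S) => [|F g] //= aF; exists F, g; split=> //.
by have := mem_gaps F Sfin; rewrite gE mem_head => /esym/negP; rewrite inE.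
Qed.

Lemma least_positive (S : set nat) n : S n -> 0 < n ->
  exists m, [/\ S m, 0 < m & forall k, S k -> 0 < k -> m <= k].
Proof.
move=> Sn n0; have ex : exists k, `[< S k >] && (0 < k).
  by exists n; rewrite n0 andbT; apply/asboolP.
case: (ex_minnP ex) => m /andP[/asboolP Sm m0] mmin; exists m; split=> // k Sk k0.
by apply: mmin; rewrite k0 andbT; apply/asboolP.
Qed.

Lemma exists_base (S : set nat) F : S 0 -> 0 < F ->
  exists B, [/\ S B, B < F & forall s, S s -> s < F -> s <= B].
Proof.
move=> S0 F0; have ex : exists k, `[< S k >] && (k < F).
  by exists 0; rewrite F0 andbT; apply/asboolP.
have bnd k : `[< S k >] && (k < F) -> k <= F by case/andP=> _ /ltnW.
case: (ex_maxnP ex bnd) => B /andP[/asboolP SB BF] Bmax; exists B; split=> // s Ss sF.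
by apply: Bmax; rewrite sF andbT; apply/asboolP.
Qed.

Lemma count_iota_rev (P : pred nat) m n :
  count (fun i => P (m + n - i)) (iota 0 n) = count P (iota m.+1 n).
Proof.
elim: n => // n IH; rewrite -[X in iota m.+1 X]addn1 iotaD count_cat /= -IH subn0 addn0.
by rewrite (iotaDl 1 0 n) count_map addnS addnC.
Qed.

(** Subtraction from [B] reverses the order, so [rev] makes the list decreasing again. *)
Lemma gaps_reflection (S : set nat) B : finite_set (~` S) -> S 0 -> S B ->
  gaps (reflection B S) = [seq B - g | g <- rev (gaps S) & g < B].
Proof.
move=> Sfin S0 SB; apply: gaps_unique => [||n].
- rewrite sorted_map; apply: (@sub_in_sorted _ [pred g | g < B] ltn).
  + by move=> x y /=; rewrite !inE /=; lia.
  + exact: filter_all.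
  + by apply: (sorted_filter ltn_trans); rewrite rev_sorted; exact: gaps_sorted.
- by apply: (@cofinite_ge _ B) => n Bn; rewrite /reflection /= ltnNge Bn.
- split=> [Tn|nT nB].
  + apply/negP => /mapP[g]; rewrite mem_filter mem_rev mem_gaps //.
    case/andP=> gB /negP gS nE; apply: gS; rewrite inE.
    have [n_lt|Bn] := ltnP n B; last by have -> : g = 0 by lia.
    by have -> : g = B - n by [lia]; exact: Tn.
  + apply: contrapT => nS; move/negP: nT; apply; apply/mapP; exists (B - n); last lia.
    rewrite mem_filter mem_rev mem_gaps //; apply/andP; split.
      (* For [n = 0] the gap would be [B], which lies in [S]. *)
      have [n0|] := posnP n; last lia.
      by case: nS; rewrite n0 subn0.
    by apply/negP; rewrite inE.
Qed.

(** As [i] runs over [[0, B - g)], [B - i] runs over [[g + 1, B]], and [g] itself counts for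
    nothing. *)
Lemma count_reflection (S : set nat) B g : ~ S g -> g < B ->
  count [in reflection B S] (iota 0 (B - g)) =
  count [in S] (iota 0 B.+1) - count [in S] (iota 0 g).
Proof.
move=> gS gB; have -> : B.+1 = g + (B - g).+1 by lia.
rewrite iotaD count_cat addKn /= add0n memNset // add0n -count_iota_rev.
apply: eq_in_count => i; rewrite mem_iota => /andP[_ iBg] /=.
rewrite subnKC; last exact: ltnW.
apply/idP/idP; rewrite !inE /reflection /=; last by [].
by apply; lia.
Qed.

(** A numerical set is determined by its diagram, so it suffices to compare diagrams. Gaps [x < B]
    of [S] give the rows of the reflection; gaps above [B] give the zero rows, which are
    discarded. *)
Lemma complement_reflection (S : set nat) B F g :
  numerical_set S -> gaps S = F :: g -> S B -> B < F ->
  (forall s, S s -> s < F -> s <= B) -> complement S = reflection B S.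
Proof.
case=> S0 Sfin gE SB BF Bmax.
have hd : head 0 (diagram S) = count [in S] (iota 0 B.+1).
  rewrite /diagram gE /= -{1}(subnKC BF) iotaD count_cat -[RHS]addn0; congr (_ + _).
  apply/eqP; rewrite eqn0Ngt -has_count; apply/hasPn => s.
  rewrite mem_iota add0n => /andP[Bs sF] /=; apply/negP; rewrite inE => Ss.
  by have := Bmax s Ss; lia.
have Tnum : numerical_set (reflection B S).
  split; first by rewrite /reflection /= subn0.
  by apply: (@cofinite_ge _ B) => n Bn; rewrite /reflection /= ltnNge Bn.
rewrite /complement -(diagramK Tnum); congr set_of_diagram.
rewrite /diagram gaps_reflection // -!map_comp /complement_diagram -/(diagram S) hd.
rewrite /diagram -map_rev -map_comp filter_map.
have gapP x : x \in rev (gaps S) -> ~ S x.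
  by rewrite mem_rev mem_gaps // => /negP; rewrite inE.
rewrite (@eq_in_filter _ _ [pred x | x < B]).
  apply/eq_in_map => x; rewrite mem_filter => /andP[/= xB /gapP xS].
  by rewrite count_reflection.
move=> x /gapP xS.
(* The row of [x] survives iff [S] meets [[x, B]]; for [x < B] the point [B] is a witness. *)
transitivity (count [in S] (iota 0 x) < count [in S] (iota 0 B.+1)).
  exact: subn_gt0.
rewrite [RHS]/=; have [xB|Bx] := ltnP x B.
  have -> : B.+1 = x + (B - x).+1 by lia.
  rewrite iotaD count_cat -[X in X < _]addn0 ltn_add2l -has_count.
  by apply/hasP; exists B; rewrite ?mem_iota ?inE //; lia.
have {}Bx : B < x by rewrite ltn_neqAle Bx andbT; apply/eqP => BE; apply: xS; rewrite -BE.
by rewrite ltnNge -(subnKC Bx) iotaD count_cat leq_addr.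
Qed.

Section Semigroup.

Variables (S : set nat) (B m : nat).
Hypotheses (S0 : S 0) (SD : forall x y, S x -> S y -> S (x + y)).
Hypotheses (SB : S B) (Sm : S m) (m_gt0 : 0 < m).
Hypothesis m_min : forall k, S k -> 0 < k -> m <= k.

Let A := associated_semigroup (reflection B S).

Lemma semigroup_mul s k : S s -> S (s + k * m).
Proof. by move=> Ss; elim: k => [|k IH]; rewrite ?addn0 // mulSn addnCA; exact: SD. Qed.

Lemma semigroup_dvdn s : m %| s -> S s.
Proof. by case/dvdnP => k ->; rewrite -[_ * _]add0n; exact: semigroup_mul. Qed.

(** [B - s] lies in the reflection, hence so does [t + (B - s) = B - (s - t)]. The case [t = s] is
    separate because [B] lies in the reflection vacuously. *)
Lemma associated_subn t s : A t -> S s -> t <= s <= B -> S (s - t).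
Proof.
case=> _ At Ss /andP[ts sB]; have [->|t_ne_s] := eqVneq t s; first by rewrite subnn.
have /At : [set t + u | u in reflection B S] (t + (B - s)).
  by exists (B - s) => // _; rewrite subKn.
rewrite /reflection /=; have -> : B - (t + (B - s)) = s - t by lia.
by apply; lia.
Qed.

(** Here [S] agrees up to [B] with the multiples of [m], so if [m] divides [B - u] and [n], then
    [B - (n + u)] stays in [S]. *)
Lemma associated_dvdn n : (forall s, S s -> s <= B -> m %| s) -> m %| n -> A n.
Proof.
move=> Sdvd mn.
have closed u : reflection B S u -> reflection B S (n + u).
  move=> Tu nuB; apply: semigroup_dvdn.
  have uB : u < B by lia.
  have -> : B - (n + u) = (B - u) - n by lia.
  by apply: dvdn_sub => //; apply: Sdvd; [exact: Tu | exact: leq_subr].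
split; last by move=> _ [u /closed ? <-].
by rewrite -[n]addn0; apply: closed => _; rewrite subn0.
Qed.

Lemma base_multiples t : A t -> 0 < t < B ->
  forall s, S s -> s <= B -> m %| s.
Proof.
move=> At /andP[t0 tB].
have mBt : m <= B - t.
  by apply: m_min; [apply: associated_subn | ]; rewrite ?leqnn ?subn_gt0 ?(ltnW tB).
have below s : S s -> s <= t -> exists k, t = s + k * m.
  (* The ceiling of [(t - s) / m]: the first point of the progression that is at least [t]. *)
  move=> Ss st; exists ((t - s + m.-1) %/ m).
  set n := s + _; have Sn : S n by exact: semigroup_mul.
  have tn : t <= n < t + m.
    have := divn_eq (t - s + m.-1) m; have := ltn_pmod (t - s + m.-1) m_gt0.
    by rewrite /n; lia.
  have /(associated_subn At Sn) Snt : t <= n <= B by lia.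
  have [|n_gt] := posnP (n - t); first lia.
  by have := m_min Snt n_gt; lia.
have mt : m %| t.
  by have [k ->] := below 0 S0 (leq0n t); rewrite dvdn_mull.
(* Elements up to [t] are settled by [below]; larger ones descend by subtracting [t]. *)
elim/ltn_ind => s IH Ss sB.
have [st|/ltnW ts] := leqP s t.
  by have [k tE] := below s Ss st; rewrite -(dvdn_addl s (dvdn_mull k (dvdnn m))) -tE.
rewrite -(subnK ts) dvdn_addl //; apply: IH; [lia | | lia].
by apply: associated_subn => //; rewrite ts.
Qed.

Lemma small_atom_associated a : small_atom A a ->
  a = m /\ forall s, S s -> s <= B -> m %| s.
Proof.
case=> -[Aa a0 aE] aF.
have AB n : B <= n -> A n.
  move=> Bn; split; first by rewrite /reflection /= ltnNge Bn.
  by move=> _ [u _ <-]; rewrite /reflection /= => ?; lia.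
have [l [_ [_ lA al]]] := lt_frobeniusP (cofinite_ge AB) aF.
(* [l] is a gap of [A], and [A] contains everything from [B] on. *)
have aB : a < B.
  by apply: ltn_trans al _; rewrite ltnNge; apply/negP => /AB.
have a_lim : 0 < a < B by rewrite a0.
have Sdvd := base_multiples Aa a_lim; split=> //.
(* Both [B] and [B - a] lie in [S], so [m] divides their difference. *)
have ma : m %| a.
  have mB : m %| B by exact: Sdvd.
  have := Sdvd (B - a) (associated_subn Aa SB _) (leq_subr _ _).
  rewrite (ltnW aB) leqnn => /(_ isT) mBa.
  by rewrite -(dvdn_addr _ mBa) subnK // ltnW.
have [//|ma_ne] := eqVneq a m; case: aE; exists m, (a - m).
have ma_le := dvdn_leq a0 ma.
by split; [exact: associated_dvdn | apply: associated_dvdn => //; exact: dvdn_sub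
  | exact: m_gt0 | lia | lia].
Qed.

(** A larger multiple of [m] splits as [m + (a - m)] inside [S]. *)
Lemma atom_dvdn a : atom S a -> m %| a -> a = m.
Proof.
case=> _ a0 aE ma; have [//|ma_ne] := eqVneq a m; case: aE; exists m, (a - m).
have ma_le := dvdn_leq a0 ma.
by split=> //; [apply: semigroup_dvdn; exact: dvdn_sub | lia | lia].
Qed.

End Semigroup.

Theorem theorem3p1 (S : set nat) (hS : numerical_semigroup S) :
  (forall a b : nat,
     small_atom (associated_semigroup (complement S)) a ->
     small_atom (associated_semigroup (complement S)) b -> a = b) /\
  ((exists a b : nat, [/\ a <> b, small_atom S a & small_atom S b]) ->
   forall a : nat, ~ small_atom (associated_semigroup (complement S)) a).
Proof.
have [[S0 Sfin] SD] := hS.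
(* Without gaps, [S] and its complement are all of [nat], and there are no small atoms. *)
case gE: (gaps S) => [|F g].
  have noA a : ~ small_atom (associated_semigroup (complement S)) a.
    have A_all n : associated_semigroup (complement S) n.
      by rewrite /complement /diagram gE; split.
    by case=> _ /(lt_frobeniusP (cofinite_ge (B := 0) (fun n _ => A_all n)))
      [l [_ [_ /(_ (A_all l))]]].
  by split=> [a b /noA|_ a /noA].
have F0 : 0 < F.
  have : F \in gaps S by rewrite gE mem_head.
  by rewrite mem_gaps // lt0n; apply: contraNneq => ->; rewrite inE.
have [B [SB BF Bmax]] := exists_base S0 F0.
rewrite (complement_reflection hS.1 gE SB BF Bmax).
(* The base may be [0], so the positive element needed to define [m] is taken above the largest
   gap. *)
have [n nA] : exists n, B < n /\ S n.
  exists F.+1; split; first exact: ltnW.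
  apply: contrapT => nS.
  have : F.+1 \in gaps S by rewrite mem_gaps //; apply/negP; rewrite inE.
  rewrite gE inE => /predU1P[|]; first lia.
  by have := gaps_sorted S; rewrite gE /= => /(order_path_min gtn_transitive)/allP H /H /=; lia.
have n0 : 0 < n by lia.
have [m [Sm m0 m_min]] := least_positive nA.2 n0.
have key := small_atom_associated S0 SD SB Sm m0 m_min.
split=> [a b /key[-> _] /key[-> _]//|[a [b [ab Sa Sb]]] c /key[_ Sdvd]].
(* A small atom of [S] lies below [F], hence is at most [B] and a multiple of [m]. *)
have small x : small_atom S x -> x = m.
  case=> Sx xF; apply: (atom_dvdn S0 SD Sm m0 Sx).
  have [F' [g' [+ _ xF']]] := lt_frobeniusP Sfin xF; rewrite gE => -[FE _].
  have [Sx' _ _] := Sx.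
  by apply: Sdvd => //; apply: Bmax => //; rewrite FE.
by apply: ab; rewrite (small a Sa) (small b Sb).
Qed.
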